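(* Let $D$ be a nonempty, convex, closed, and bounded subset of a real Hilbert space $H$, and let $f:D\to\mathbb{R}$ be a smooth convex function whose gradient $f'$ satisfies the Lipschitz condition on $D$ with constant $L$. Apply Method (CGRM) (described in the context) with parameter sequences $\{\delta_l\}$, $\{\varepsilon_l\}$ satisfying $$\lim_{l\to\infty}\frac{\delta_l}{\varepsilon_l}=0.$$ Then: (i) for each number $l$ the number of iterations in $k$ is finite; (ii) the sequence $\{w^{l}\}$ converges strongly to the point $x^{*}_{n}$, the unique solution of the problem of minimizing $0.5\|x\|^{2}$ over $x\in D^{*}(f)$, where $D^{*}(f)$ is the set of minimizers of $f$ over $D$.
   Context: Notation. For $\varepsilon>0$ set $\varphi_{\varepsilon}(x)=f(x)+0.5\varepsilon\|x\|^{2}$, with gradient $\varphi_{\varepsilon}'(x)=f'(x)+\varepsilon x$. $\{a_l\}\searrow 0$ means that $\{a_l\}$ is a decreasing sequence of positive numbers converging to $0$. $\mathbb{Z}_{+}$ is the set of non-negative integers. Method (CGRM). Step 0: Choose a point $w^{0}\in D$, numbers $\beta\in(0,1)$, $\theta\in(0,1)$, sequences $\{\delta_l\}\searrow 0$ and $\{\varepsilon_l\}\searrow 0$ (indexed by $l=0,1,\ldots$). Set $l=1$. Step 1: Set $x^{0}=w^{l-1}$, $k=0$. Step 2: Find a point $y^{k}\in D$ as a solution of the problem of minimizing $\langle\varphi_{\varepsilon_l}'(x^{k}),y\rangle$ over $y\in D$; set $d^{k}=y^{k}-x^{k}$, $\mu_{k,l}=-\langle\varphi_{\varepsilon_l}'(x^{k}),d^{k}\rangle$.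 If $\mu_{k,l}\le\delta_l$, set $w^{l}=x^{k}$, $l=l+1$ and go to Step 1. Step 3: Determine $m$ as the smallest number in $\mathbb{Z}_{+}$ such that $$\theta^{m}\mu_{k,l}\le 1,\qquad \varphi_{\varepsilon_l}(x^{k}+\theta^{m}\mu_{k,l}d^{k})\le\varphi_{\varepsilon_l}(x^{k})-\beta\theta^{m}\mu_{k,l}^{2},$$ set $\lambda_k=\theta^{m}$, $x^{k+1}=x^{k}+\lambda_k\mu_{k,l}d^{k}$, $k=k+1$, and go to Step 2. (The points $x^k,y^k$ depend also on the current $l$; this dependence is suppressed.) *)

(* Defs.v *)
From HB Require Import structures.
From mathcomp Require Import all_boot all_order all_algebra.
From mathcomp Require Import sesquilinear.
From mathcomp Require Import all_classical all_reals all_analysis.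

Set Implicit Arguments.
Unset Strict Implicit.
Unset Printing Implicit Defensive.

Import Order.TTheory GRing.Theory Num.Theory.
Import numFieldNormedType.Exports.

Local Open Scope classical_set_scope.
Local Open Scope ring_scope.

(* Monotonicity is weak, so strictly decreasing sequences are included. *)
Definition decreases_to0 (R : realType) (a : nat -> R) : Prop :=
  [/\ forall l, 0 < a l, nonincreasing_seq a & a @ \oo --> (0 : R)].

Definition minimizers (T : Type) (R : realType) (D : set T) (h : T -> R) :
  set T := [set x | D x /\ forall z, D z -> h x <= h z].

Section Hilbert.
Context (R : realType) (H : completeNormedModType R).

(* With [inner_product_norm ip], the complete normed space H is a real Hilbert
   space with inner product ip. *)
Definition inner_product_norm (ip : {dot H for (@idfun R)}) : Prop :=
  forall x : H, `|x| ^+ 2 = ip x x.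

Context (ip : {dot H for (@idfun R)}).

(* A function on D is represented by a total one whose values outside D are
   irrelevant.  D may have empty interior, so the Frechet remainder is taken
   along D only; the gradient f' is then data, since D need not determine it. *)
Definition gradient_on (D : set H) (f : H -> R) (f' : H -> H) : Prop :=
  forall x, D x ->
    (fun y : H => f y - f x - ip (f' x) (y - x) : R^o)
      =o_ (within D (nbhs x)) (fun y : H => y - x).

Definition reg (f : H -> R) (e : R) (x : H) : R :=
  f x + 2^-1 * e * `|x| ^+ 2.

Definition reg_grad (f' : H -> H) (e : R) (x : H) : H := f' x + e *: x.

(* Conditional gradient method for the regularized functions
   f + (eps l / 2) |.|^2, run to gap accuracy delta l, for l = 1, 2, ...;
   stage l starts at w (l - 1) and produces w l. *)
Section Method.
Variables (D : set H) (f : H -> R) (f' : H -> H).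
Variables (beta theta : R) (delta eps : nat -> R).

Definition direction_point (e : R) (x y : H) : Prop :=
  minimizers D (fun z => ip (reg_grad f' e x) z) y.

Definition gap (e : R) (x y : H) : R := - ip (reg_grad f' e x) (y - x).

Definition armijo (e : R) (x y : H) (m : nat) : Prop :=
  let mu := gap e x y in
  theta ^+ m * mu <= 1 /\
  reg f e (x + (theta ^+ m * mu) *: (y - x))
    <= reg f e x - beta * theta ^+ m * mu ^+ 2.

Definition armijo_first (e : R) (x y : H) (m : nat) : Prop :=
  armijo e x y m /\ forall j, (j < m)%N -> ~ armijo e x y j.

(* At no feasible point can stage l get stuck: the linear subproblem is
   solvable and, unless the stage stops there, the backtracking is finite. *)
Definition steps_executable (l : nat) : Prop :=
  forall x, D x ->
    (exists y, direction_point (eps l) x y) /\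
    (forall y, direction_point (eps l) x y -> delta l < gap (eps l) x y ->
      exists m, armijo_first (eps l) x y m).

(* From here on, x l k and y l k are the iterate x^k and the subproblem solution
   y^k of stage l. *)
Definition stage_ends_at (x y : nat -> nat -> H) (l k : nat) : Prop :=
  (forall j, (j < k)%N -> delta l < gap (eps l) (x l j) (y l j)) /\
  gap (eps l) (x l k) (y l k) <= delta l.

(* The execution reaches iteration k of stage l: all earlier stages have ended,
   and stage l has not stopped before k. *)
Definition visited (x y : nat -> nat -> H) (l k : nat) : Prop :=
  [/\ (0 < l)%N,
      forall i, (0 < i < l)%N -> exists K, stage_ends_at x y i K &
      forall j, (j < k)%N -> delta l < gap (eps l) (x l j) (y l j)].

(* Entries at indices that are never visited are unconstrained; in
   particular no stage is assumed to end. *)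
Record cgrm_run (w : nat -> H) (x y : nat -> nat -> H) : Prop := CgrmRun {
  cgrm_start : D (w 0%N);
  cgrm_step1 : forall l, visited x y l 0 -> x l 0%N = w l.-1;
  cgrm_step2 : forall l k, visited x y l k ->
    direction_point (eps l) (x l k) (y l k);
  cgrm_stop : forall l k, visited x y l k ->
    gap (eps l) (x l k) (y l k) <= delta l -> w l = x l k;
  cgrm_step3 : forall l k, visited x y l k ->
    delta l < gap (eps l) (x l k) (y l k) ->
    exists m, armijo_first (eps l) (x l k) (y l k) m /\
      x l k.+1 = x l k +
        (theta ^+ m * gap (eps l) (x l k) (y l k)) *: (y l k - x l k)
}.

End Method.
End Hilbert.

(* Main.v *)
(** Each regularized function f + (e/2)|.|^2 is strongly convex on D with a
    Lipschitz gradient, so one common step theta^m passes the Armijo test at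
    every feasible point; an endless stage would then lower the value by a fixed
    amount at each iteration, although f is bounded below on D.

    At the end of stage l the small gap and strong convexity give, for every
    minimizer q of f,
      |w_l|^2 + |q - w_l|^2 <= |q|^2 + 2 delta_l / eps_l,
    and f(w_l) -> min f.  Weak compactness is replaced by the parallelogram
    identity: almost-minimal-norm points of the nested sublevel sets of f form a
    Cauchy sequence, so that near-minimizers of f have norm at least |x*_n|, up
    to a small error.  The displayed inequality with q = x*_n then forces
    w_l -> x*_n. *)

Require Import Defs.
From mathcomp Require Import all_boot all_order all_algebra.
From mathcomp Require Import sesquilinear.
From mathcomp Require Import all_classical all_reals all_analysis.
From mathcomp Require Import ring lra.

Set Implicit Arguments.
Unset Strict Implicit.
Unset Printing Implicit Defensive.

Import Order.TTheory GRing.Theory Num.Theory.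
Import numFieldNormedType.Exports.
Local Open Scope classical_set_scope.
Local Open Scope ring_scope.

(** * Inner product identities and a parallelogram substitute for weak compactness *)

Section HilbertGeometry.
Context (R : realType) (H : completeNormedModType R).
Context (ip : {dot H for (@idfun R)}) (ip_norm : inner_product_norm ip).
Implicit Types (x y z p : H) (D : set H).

Lemma ipC x y : ip x y = ip y x.
Proof. by have := @hermitian_subproof _ _ _ _ ip x y; rewrite expr0 mul1r. Qed.

Lemma ipZl (a : R) x y : ip (a *: x) y = a * ip x y.
Proof. by rewrite linearZl. Qed.

Lemma ipZr (a : R) x y : ip x (a *: y) = a * ip x y.
Proof. by rewrite linearZr. Qed.

Lemma ipBl x y z : ip (x - y) z = ip x z - ip y z.
Proof. by rewrite linearBl. Qed.

Lemma ipNr x y : ip x (- y) = - ip x y.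
Proof. by rewrite linearNr. Qed.

Lemma normD_sqr x y : `|x + y| ^+ 2 = `|x| ^+ 2 + 2 * ip x y + `|y| ^+ 2.
Proof. by rewrite !ip_norm linearDl !linearDr/= (ipC y x); ring. Qed.

Lemma cauchy_schwarz x y : ip x y <= `|x| * `|y|.
Proof.
have [->|x0] := eqVneq x 0; first by rewrite linear0l normr0 mul0r.
have [->|y0] := eqVneq y 0; first by rewrite linear0r normr0 mulr0.
have xy0 : 0 < `|x| * `|y| by rewrite mulr_gt0 ?normr_gt0.
have := sqr_ge0 `|(`|y| *: x) + (- `|x|) *: y|.
rewrite normD_sqr !normrZ !normrN !normr_id ipZl ipZr.
rewrite (_ : _ + _ = 2 * (`|x| * `|y|) * (`|x| * `|y| - ip x y)); last by ring.
by rewrite (pmulr_rge0 _ (mulr_gt0 _ xy0))// subr_ge0.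
Qed.

(** The midpoint has the form that [convex_segment] gives at [t = 1/2]. *)
Lemma parallelogram x y :
  `|x - y| ^+ 2 = 2 * `|x| ^+ 2 + 2 * `|y| ^+ 2
                  - 4 * `|x + 2^-1 *: (y - x)| ^+ 2.
Proof.
rewrite !normD_sqr normrN linearNr !ipZr linearBr/= normrZ.
rewrite -(normrN (y - x)) opprB exprMn normD_sqr normrN linearNr/=.
rewrite -(ip_norm x) ger0_norm ?invr_ge0//; by field.
Qed.

Lemma convex_segment D x y (t : R) : convex_set D -> D x -> D y ->
  0 <= t <= 1 -> D (x + t *: (y - x)).
Proof.
move=> cD Dx Dy /andP[t0 t1].
have := cD y x (Itv01 t0 t1) (mem_set Dy) (mem_set Dx).
rewrite inE /conv/=.
by congr D; rewrite scalerBl scale1r scalerBr addrCA.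
Qed.

Lemma bounded_diam D : bounded_set D ->
  exists2 B : R, 0 < B & forall x y, D x -> D y -> `|x| <= B /\ `|y - x| <= B.
Proof.
move=> /pinfty_ex_gt0[M M0 DM].
have xM x : D x -> `|x| <= M by exact: DM.
exists (2 * M) => [|x y Dx Dy]; first by rewrite mulr_gt0.
have := xM _ Dx; have := xM _ Dy; have := ler_normB y x; split; lra.
Qed.

(** Midpoints of two near-minimal points stay in an earlier [C N], where the norm cannot fall much
    below its limiting infimum, so the parallelogram identity forces such points together.
    Closedness puts their limit in every [C n]. *)
Lemma nested_min_norm (C : nat -> set H) (M : R) :
  (forall n m, (n <= m)%N -> C m `<=` C n) ->
  (forall n x y, C n x -> C n y -> C n (x + 2^-1 *: (y - x))) ->
  (forall n, closed (C n)) ->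
  (forall n, exists2 z, C n z & `|z| ^+ 2 <= M) ->
  exists2 p, (forall n, C n p) &
    forall e : R, 0 < e -> exists n, forall z, C n z -> `|p| ^+ 2 <= `|z| ^+ 2 + e.
Proof.
move=> Cdec Cmid Ccl CM.
(* Its supremum [l] is the limit of the infima of the squared norm over [C n]; [M] keeps it
   finite. *)
pose S := [set c : R | exists n, forall z, C n z -> c <= `|z| ^+ 2].
have supS : has_sup S.
  split; first by exists 0, 0%N => z _; exact: sqr_ge0.
  by exists M => c [n cn]; have [z Cz zM] := CM n; exact: le_trans (cn z Cz) zM.
pose l := sup S.
have below (e : R) : 0 < e -> exists n, forall z, C n z -> l - e < `|z| ^+ 2.
  move=> e0; have [c [n cn] lc] := sup_adherent e0 supS.
  by exists n => z Cz; exact: lt_le_trans lc (cn z Cz).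
have above n (e : R) : 0 < e -> exists z, C n z /\ `|z| ^+ 2 < l + e.
  move=> e0; apply: contrapT => /forallNP nz.
  have /(ub_le_sup supS.2) : S (l + e).
    exists n => z Cz; rewrite leNgt; apply/negP => zl.
    exact: (nz z).
  by rewrite -/l; lra.
have inv0 n : 0 < n.+1%:R^-1 :> R by rewrite invr_gt0.
have /choice[z zP] : forall n, exists z, C n z /\ `|z| ^+ 2 < l + n.+1%:R^-1.
  by move=> n; exact: above.
have tail (e : R) : 0 < e -> \forall n \near \oo,
    C n (z n) /\ `|z n| ^+ 2 < l + e.
  move=> e0; near=> n; have [Cz zl] := zP n; split => //.
  apply: (lt_trans zl); rewrite ltrD2l; near: n.
  exact: (near_infty_natSinv_lt (PosNum e0)).
have cz : cvg (z @ \oo).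
  apply/cauchy_cvgP/cauchy_exP => e e0.
  (* The parallelogram bound will be [4 (l + d) - 4 (l - d) = 8 d]. Below, [N] controls the midpoint
     from below and [n0] the two endpoints from above. *)
  pose d := e ^+ 2 / 8; have d0 : 0 < d by rewrite divr_gt0// exprn_gt0.
  have [N lN] := below d d0.
  have [n0 _ nP] := tail d d0.
  exists (z (maxn N n0)); exists (maxn N n0) => // n /= nN.
  have [CN zN] := nP (maxn N n0) (leq_maxr _ _).
  have [Cn zn] : C n (z n) /\ `|z n| ^+ 2 < l + d.
    by apply: nP; exact: leq_trans (leq_maxr _ _) nN.
  have := lN _ (Cmid N _ _ (Cdec _ _ (leq_maxl N n0) _ CN)
    (Cdec _ _ (leq_trans (leq_maxl N n0) nN) _ Cn)).
  have := parallelogram (z (maxn N n0)) (z n).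
  rewrite -ball_normE/= -(ltr_pXn2r (n := 2)) ?nnegrE ?normr_ge0 ?ltW//.
  rewrite /d in zN zn *; lra.
exists (lim (z @ \oo)) => [n|e e0].
  apply: (closed_cvg (C n) (Ccl n) _ _ cz).
  near=> m; apply: (Cdec n m); first by near: m; exact: nbhs_infty_ge.
  by have [] := zP m.
have e20 : 0 < e / 2 by rewrite divr_gt0.
have pl : `|lim (z @ \oo)| ^+ 2 <= l + e / 2.
  have cz2 : `|z n| ^+ 2 @[n --> \oo] --> `|lim (z @ \oo)| ^+ 2.
    have cn : `|z n| @[n --> \oo] --> `|lim (z @ \oo)| by exact: cvg_norm.
    by under eq_cvg do rewrite expr2; rewrite expr2; exact: cvgM.
  rewrite -(cvg_lim _ cz2)//; apply: limr_le; first by apply: cvgP cz2.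
  by have := tail _ e20; apply: filterS => n [_ /ltW].
have [n nP] := below _ e20; exists n => y /nP; lra.
Unshelve. all: by end_near. Qed.

End HilbertGeometry.

(** * Subgradient inequalities and least-norm minimizers of convex functions *)

Section ConvexMinimization.
Context (R : realType) (H : completeNormedModType R).
Context (ip : {dot H for (@idfun R)}) (ip_norm : inner_product_norm ip).
Context (D : set H) (cD : convex_set D).

(** The remainder is controlled only along [D], so it is evaluated at a point of the segment from
    [x] to [z]. Convexity bounds [f] there from above, and dividing by [t] leaves the claim up to
    [e]. *)
Lemma convex_gradient_le (f : H -> R) (f' : H -> H) :
  convex_function D f -> gradient_on ip D f f' ->
  forall x z, D x -> D z -> f x + ip (f' x) (z - x) <= f z.
Proof.
move=> cf gf x z Dx Dz; apply/ler_addgt0Pr => e e0.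
pose s := `|z - x|; have s0 : 0 <= s by exact: normr_ge0.
(* Dividing by [s + 1] instead of [s] covers [z = x], and makes [t * s < r] strict below. *)
have s1 : 0 < s + 1 by lra.
have es0 : 0 < e / (s + 1) by rewrite divr_gt0.
have := gf x Dx => /eqoP/(_ _ es0)/nbhs_ballP[r/= r0 rP].
pose t := Num.min 1 (r / (s + 1)).
have t0 : 0 < t by rewrite lt_min ltr01 divr_gt0.
have t1 : t <= 1 by rewrite ge_min lexx.
have t01 : 0 <= t <= 1 by rewrite ltW.
have ts : t * s < r.
  have : t <= r / (s + 1) by rewrite ge_min lexx orbT.
  rewrite ler_pdivlMr// => ?; nra.
have := rP (x + t *: (z - x)) _ (convex_segment cD Dx Dz t01).
have -> : x + t *: (z - x) - x = t *: (z - x) by rewrite addrC addKr.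
rewrite -ball_normE/= distrC [X in `|X| < r]addrC addKr normrZ (gtr0_norm t0).
move=> /(_ ts); rewrite ipZr -/s ler_norml => /andP[+ _].
have := cf (Itv01 (ltW t0) t1) z x (mem_set Dz) (mem_set Dx).
rewrite /conv/= -[X in f X <= _]/(t *: z + (1 - t) *: x : H).
rewrite -[X in _ <= X]/(t * f z + (1 - t) * f x).
have -> : t *: z + (1 - t) *: x = x + t *: (z - x).
  by rewrite scalerBl scale1r scalerBr addrCA.
move=> fy ey.
have es : e / (s + 1) * s <= e.
  by rewrite -mulrA ler_piMr ?ltW// mulrC ltr_pdivrMr//; lra.
rewrite -(ler_pM2l t0); nra.
Qed.

(** A subgradient at each point of [D] supplies all that [nested_min_norm] needs of the sublevel
    sets of [h]: a finite infimum, stability under midpoints, and closedness. A general [h] serves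
    both [f] and the linear subproblem. *)
Lemma minimizer_approx (h : H -> R) :
  D !=set0 -> closed D -> bounded_set D ->
  (forall x, D x -> exists g, forall z, D z -> h x + ip g (z - x) <= h z) ->
  exists p, minimizers D h p /\ forall e, 0 < e ->
    exists2 c, h p < c & forall z, D z -> h z <= c -> `|p| ^+ 2 <= `|z| ^+ 2 + e.
Proof.
move=> [a Da] Dcl /bounded_diam[B B0 DB] sub.
have [g gP] := sub a Da.
have hinf : has_inf (h @` D).
  split; first by exists (h a), a.
  exists (h a - `|g| * B) => _ [z Dz <-]; apply: le_trans (gP z Dz).
  have := cauchy_schwarz ip_norm (- g) (z - a).
  rewrite linearNl normrN/=.
  have := ler_wpM2l (normr_ge0 g) (DB _ _ Da Dz).2; lra.
pose v := inf (h @` D).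
have vh z : D z -> v <= h z by move=> Dz; apply: ge_inf; [exact: hinf.2|exists z].
have inv0 n : 0 < n.+1%:R^-1 :> R by rewrite invr_gt0.
pose C n := [set z | D z /\ h z <= v + n.+1%:R^-1].
have [n m nm z [Dz zm]||||] := @nested_min_norm _ _ ip ip_norm C (B ^+ 2).
- by split => //; apply: (le_trans zm); rewrite lerD2l lef_pV2 ?posrE// ler_nat.
(* The subgradient inequalities at the midpoint, tested at [x] and [y], have opposite linear terms,
   which cancel in the sum. *)
- move=> n x y [Dx hx] [Dy hy].
  have Dm : D (x + 2^-1 *: (y - x)) by apply: convex_segment => //; lra.
  split => //; have [k kP] := sub _ Dm; have := kP x Dx; have := kP y Dy.
  set m := x + _ in Dm kP *.
  have -> : x - m = - (2^-1 *: (y - x)) by rewrite /m opprD addrA subrr add0r.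
  have -> : y - m = 2^-1 *: (y - x).
    rewrite /m opprD addrA -[X in X - _]scale1r -scalerBl.
    by congr (_ *: _); field.
  rewrite linearNr/=; move: (v + _) hx hy => w; lra.
(* Lower semicontinuity: the subgradient [k] at the limit [z] gives [h z <= h y + |k| |z - y|] for
   nearby [y] in the set. *)
- move=> n; rewrite closure_id eqEsubset; split; first exact: subset_closure.
  move=> z zC; have Dz : D z.
    by apply: Dcl; move: zC; apply: closureS => ? [].
  split => //; have [k kP] := sub z Dz; apply/ler_addgt0Pr => e e0.
  have ek0 : 0 < e / (`|k| + 1) by rewrite divr_gt0// ltr_wpDl.
  have [y [[Dy hy]]] := zC _ (nbhsx_ballx z _ ek0).
  rewrite -ball_normE/= => zy; have := kP y Dy.
  have := cauchy_schwarz ip_norm k (z - y).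
  have : `|k| * `|z - y| <= e.
    have : (`|k| + 1) * `|z - y| <= e by rewrite mulrC -ler_pdivlMr ?ltW// ltr_wpDl.
    have := normr_ge0 (z - y); lra.
  rewrite -(opprB z y) linearNr/=; move: (v + _) hy => w; lra.
- move=> n; have [_ [z Dz <-] zv] := inf_adherent (inv0 n) hinf.
  exists z; first by split => //; exact: ltW.
  by rewrite ler_pXn2r ?nnegrE// ?(DB z z Dz Dz).1// ltW.
move=> p Cp pe.
have pv : h p = v.
  apply/eqP; rewrite eq_le vh ?andbT; last exact: (Cp 0%N).1.
  apply/ler_addgt0Pr => e e0.
  have [n _ /(_ n (leqnn n)) ne] := near_infty_natSinv_lt (PosNum e0).
  by apply: (le_trans (Cp n).2); rewrite lerD2l ltW.
exists p; split; first by split; [exact: (Cp 0%N).1|move=> z /vh; rewrite pv].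
move=> e /pe[n nP]; exists (v + n.+1%:R^-1); first by rewrite pv ltrDl.
by move=> z Dz hz; exact: nP.
Qed.

End ConvexMinimization.

(** * Backtracking and descent within one stage *)

Lemma armijo_first_exists (R : realType) (H : completeNormedModType R)
    (ip : {dot H for (@idfun R)}) (f : H -> R) (f' : H -> H) (beta theta e : R)
    (x y : H) (m : nat) :
  armijo ip f f' beta theta e x y m ->
  exists n, armijo_first ip f f' beta theta e x y n.
Proof.
move=> /asboolP am; have exm : exists n, `[< armijo ip f f' beta theta e x y n >].
  by exists m.
case: (ex_minnP exm) => n /asboolP an nmin; exists n; split => // j jn aj.
by have /nmin := asboolT aj; rewrite leqNgt jn.
Qed.

Section ConditionalGradient.
Context (R : realType) (H : completeNormedModType R).
Context (ip : {dot H for (@idfun R)}) (ip_norm : inner_product_norm ip).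
Context (D : set H) (D0 : D !=set0) (cD : convex_set D) (bD : bounded_set D).
Context (f : H -> R) (f' : H -> H) (L : R).
Hypothesis f_le : forall x z, D x -> D z -> f x + ip (f' x) (z - x) <= f z.

(** The quadratic term expands exactly around [x]; only [f] contributes an inequality. *)
Lemma reg_strongly_convex (e : R) (x z : H) : D x -> D z ->
  reg f e x + ip (reg_grad f' e x) (z - x) + 2^-1 * e * `|z - x| ^+ 2
    <= reg f e z.
Proof.
move=> Dx Dz; have := f_le Dx Dz; rewrite /reg /reg_grad linearDl/= ipZl.
have -> : `|z| ^+ 2 = `|x| ^+ 2 + 2 * ip x (z - x) + `|z - x| ^+ 2.
  by rewrite -(normD_sqr ip_norm) addrC subrK.
lra.
Qed.

(** Since [y] minimizes the linear form, its slope from [x] towards any [z] is at least [- gap].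
    This turns the stopping test into an accuracy estimate. *)
Lemma reg_small_gap (e d : R) (x y z : H) : D x -> D z ->
  direction_point ip D f' e x y -> gap ip f' e x y <= d ->
  reg f e x + 2^-1 * e * `|z - x| ^+ 2 <= reg f e z + d.
Proof.
move=> Dx Dz [_ /(_ z Dz)]; have := reg_strongly_convex e Dx Dz.
rewrite /gap !linearBr/=; lra.
Qed.

Hypothesis f'_lip : L.-lipschitz_D f'.

(** [L] carries no sign assumption and may be negative when [D] is a single point, hence [|L|]. *)
Lemma reg_grad_lipschitz (e : R) (x z : H) : 0 <= e -> D x -> D z ->
  `|reg_grad f' e z - reg_grad f' e x| <= (`|L| + e) * `|z - x|.
Proof.
move=> e0 Dx Dz; rewrite /reg_grad opprD addrACA -scalerBr.
apply: (le_trans (ler_normD _ _)); rewrite mulrDl normrZ (ger0_norm e0) lerD2r.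
have /le_trans : `|f' z - f' x| <= L * `|z - x|.
  exact: (f'_lip (conj Dz Dx : (D `*` D) (z, x))).
by apply; rewrite ler_wpM2r// ler_norm.
Qed.

Lemma reg_grad_bounded (e : R) : 0 <= e ->
  exists2 G : R, 0 < G & forall x y, D x -> D y ->
    `|ip (reg_grad f' e x) (y - x)| <= G.
Proof.
move=> e0; have [B B0 DB] := bounded_diam bD; have [a Da] := D0.
pose g := `|reg_grad f' e a|; have g0 : 0 <= g by exact: normr_ge0.
have L0 := normr_ge0 L.
have LB : 0 <= (`|L| + e) * B by rewrite mulr_ge0// ?addr_ge0// ltW.
exists ((g + (`|L| + e) * B + 1) * B) => [|x y Dx Dy].
  by rewrite mulr_gt0//; lra.
have gx : `|reg_grad f' e x| <= g + (`|L| + e) * B.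
  rewrite -[reg_grad f' e x](subrK (reg_grad f' e a)) addrC.
  apply: (le_trans (ler_normD _ _)); rewrite lerD2l.
  apply: (le_trans (reg_grad_lipschitz e0 Da Dx)); rewrite ler_wpM2l ?addr_ge0//.
  exact: (DB _ _ Da Dx).2.
have yx : `|reg_grad f' e x| * `|y - x| <= (g + (`|L| + e) * B + 1) * B.
  apply: ler_pM => //; last exact: (DB _ _ Dx Dy).2.
  by apply: (le_trans gx); rewrite lerDl.
rewrite ler_norml lerNl; apply/andP; split; apply: le_trans yx.
  by rewrite -linearNr/= -(normrN (y - x)); exact: cauchy_schwarz.
exact: cauchy_schwarz.
Qed.

Context (beta theta : R) (beta01 : 0 < beta < 1) (theta01 : 0 < theta < 1).

(* Convexity applied at the new point stands in for the usual descent lemma; it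
   costs a factor 2 in the quadratic term but needs no integration along the
   segment. *)
Lemma armijo_uniform (e : R) : 0 <= e ->
  exists m, forall x y, D x -> D y -> 0 < gap ip f' e x y ->
    armijo ip f f' beta theta e x y m.
Proof.
move=> e0; have [B B0 DB] := bounded_diam bD; have [G G0 DG] := reg_grad_bounded e0.
have /andP[b0 b1] := beta01; have /andP[th0 th1] := theta01.
pose K : R := `|L| + e; have K0 : 0 <= K by rewrite addr_ge0.
have KB : 0 < K * B ^+ 2 + 1.
  by rewrite ltr_wpDl// mulr_ge0// exprn_ge0// ltW.
(* The first bound gives [t * mu <= 1], as [mu <= G]. The second pays for the quadratic term; its
   [+ 1] avoids a zero denominator. *)
pose c := Num.min G^-1 ((1 - beta) / (K * B ^+ 2 + 1)).
have c0 : 0 < c by rewrite lt_min invr_gt0 G0 divr_gt0// subr_gt0.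
have thc : theta ^+ n @[n --> \oo] --> (0 : R) by apply: cvg_expr; rewrite gtr0_norm.
have [m _ /(_ m (leqnn m))] := (cvgr0_norm_lt _ thc) _ c0.
rewrite /= gtr0_norm ?exprn_gt0//; set t := theta ^+ m => tc.
have t0 : 0 < t by rewrite exprn_gt0.
exists m => x y Dx Dy; set mu := gap _ _ _ _ _ => mu0.
have muG : mu <= G by apply: le_trans (DG x y Dx Dy); rewrite -normrN ler_norm.
have tmu : t * mu <= 1.
  have : t <= G^-1 by rewrite (le_trans (ltW tc))// ge_min lexx.
  rewrite -(ler_pM2r G0) mulVf ?gt_eqF//; apply: le_trans.
  by rewrite ler_wpM2l// ltW.
have tK : t * (K * B ^+ 2) <= 1 - beta.
  have : t * (K * B ^+ 2 + 1) <= 1 - beta.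
    by rewrite -ler_pdivlMr// (le_trans (ltW tc))// ge_min lexx orbT.
  lra.
split => //; rewrite -/t -/mu.
have s0 : 0 < t * mu by rewrite mulr_gt0.
set z := x + _.
have Dz : D z by apply: convex_segment => //; rewrite ltW.
have zx : z - x = (t * mu) *: (y - x) by rewrite /z addrC addKr.
have := reg_strongly_convex e Dz Dx.
have : 0 <= 2^-1 * e * `|x - z| ^+ 2 by rewrite !mulr_ge0 ?exprn_ge0.
have : ip (reg_grad f' e z - reg_grad f' e x) (z - x)
    <= K * (B ^+ 2 * (t * mu) ^+ 2).
  apply: le_trans (cauchy_schwarz ip_norm _ _) _.
  apply: (le_trans (ler_wpM2r (normr_ge0 _) (reg_grad_lipschitz e0 Dx Dz))).
  rewrite -mulrA ler_wpM2l// -expr2 -exprMn.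
  rewrite ler_pXn2r ?nnegrE// ?(mulr_ge0 (ltW B0) (ltW s0))//.
  rewrite zx normrZ gtr0_norm// [leLHS]mulrC ler_wpM2r ?(ltW s0)//.
  exact: (DB _ _ Dx Dy).2.
have dmu : ip (reg_grad f' e x) (y - x) = - mu by rewrite opprK.
rewrite ipBl -(opprB z x) ipNr zx !ipZr dmu.
set u := ip (reg_grad f' e z) _ => hu h0 hz.
(* So far the value at [z] is at most that at [x] minus [t * mu ^+ 2] plus the left side here. *)
have : t * (K * B ^+ 2) * (t * mu ^+ 2) <= (1 - beta) * (t * mu ^+ 2).
  by rewrite ler_wpM2r// mulr_ge0 ?exprn_ge0// ltW.
lra.
Qed.

(** Being first, each Armijo index is at most the common [m0], so every step gains at least [q]. The
    total gain cannot exceed [G], contradicting the Archimedean property. *)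
Lemma stage_finite (e d : R) (x y : nat -> H) : 0 <= e -> 0 < d ->
  (forall k, D (x k) /\ D (y k)) ->
  (forall k, d < gap ip f' e (x k) (y k)) ->
  ~ forall k, exists m, armijo_first ip f f' beta theta e (x k) (y k) m /\
      x k.+1 = x k + (theta ^+ m * gap ip f' e (x k) (y k)) *: (y k - x k).
Proof.
move=> e0 d0 Dxy gd step; have [G G0 DG] := reg_grad_bounded e0.
have [m0 am0] := armijo_uniform e0.
have /andP[b0 b1] := beta01; have /andP[th0 th1] := theta01.
pose q := beta * theta ^+ m0 * d ^+ 2.
have q0 : 0 < q by rewrite !mulr_gt0// exprn_gt0.
have dec k : reg f e (x k) <= reg f e (x 0%N) - k%:R * q.
  elim: k => [|k IH]; first by rewrite mul0r subr0.
  have [m [[[_ am] mfirst] ->]] := step k; apply: (le_trans am).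
  have mm0 : (m <= m0)%N.
    rewrite leqNgt; apply/negP => /mfirst; apply; have [? ?] := Dxy k.
    by apply: am0 => //; exact: lt_trans (gd k).
  have qle : q <= beta * theta ^+ m * gap ip f' e (x k) (y k) ^+ 2.
    rewrite /q; apply: ler_pM.
    - by rewrite mulr_ge0 ?exprn_ge0// ltW.
    - by rewrite exprn_ge0// ltW.
    - by rewrite ler_pM2l// ler_wiXn2l// ltW.
    - by rewrite lerXn2r ?nnegrE// ltW// (lt_trans d0 (gd k)).
  by rewrite -natr1 mulrDl mul1r; lra.
have low k : reg f e (x 0%N) - G <= reg f e (x k).
  have := reg_strongly_convex e (Dxy 0%N).1 (Dxy k).1.
  have := DG _ _ (Dxy 0%N).1 (Dxy k).1; rewrite ler_norml => /andP[+ _].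
  have : 0 <= 2^-1 * e * `|x k - x 0%N| ^+ 2 by rewrite !mulr_ge0 ?exprn_ge0.
  lra.
have := archi_boundP (ltW (divr_gt0 G0 q0)); set k := Num.bound _.
rewrite ltr_pdivrMr// => Gk; have := dec k; have := low k; lra.
Qed.

End ConditionalGradient.

(** * Feasibility of the iterates and termination of every stage *)

Section Run.
Context (R : realType) (H : completeNormedModType R).
Context (ip : {dot H for (@idfun R)}) (D : set H) (cD : convex_set D).
Context (f : H -> R) (f' : H -> H) (beta theta : R) (delta eps : nat -> R).
Context (w : nat -> H) (x y : nat -> nat -> H).
Hypothesis delta0 : forall l, 0 < delta l.
Hypothesis theta0 : 0 < theta.
Hypothesis run : cgrm_run ip D f f' beta theta delta eps w x y.

(** The test [theta ^+ m * mu <= 1] keeps each new iterate on the segment from [x l k] to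
    [y l k]. *)
Lemma visited_iterate_in l k :
  visited ip f' delta eps x y l k -> D (w l.-1) -> D (x l k).
Proof.
move=> vlk Dw; elim: k vlk => [|k IH] vlk; first by rewrite (cgrm_step1 run vlk).
have [l0 done before] := vlk.
have vk : visited ip f' delta eps x y l k by split=> // j /ltnW/before.
have gk := before k (leqnn _).
have [m [[[mu1 _] _] ->]] := cgrm_step3 run vk gk.
apply: convex_segment => //; [exact: IH|exact: (cgrm_step2 run vk).1|].
by rewrite mu1 mulr_ge0 ?exprn_ge0// ltW// (lt_trans (delta0 l)).
Qed.

(** Strong induction on [l], because [visited] at stage [l] presupposes that all earlier stages
    ended. Feasibility of [w l] is carried along for the next stage; the analytic part is isolated
    in the hypothesis. *)
Lemma stages_end :
  (forall l, (forall k, visited ip f' delta eps x y l k) -> D (w l.-1) -> False) ->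
  forall l, (0 < l)%N ->
    (exists K, stage_ends_at ip f' delta eps x y l K) /\
    [/\ D (w l) & exists2 z, direction_point ip D f' (eps l) (w l) z &
          gap ip f' (eps l) (w l) z <= delta l].
Proof.
move=> noloop; elim/ltn_ind => l IH l0.
have earlier i : (0 < i < l)%N -> exists K, stage_ends_at ip f' delta eps x y i K.
  by case/andP => i0 il; exact: (IH i il i0).1.
have Dw : D (w l.-1).
  (* Stage 1 starts at [w 0], which the induction hypothesis does not cover. *)
  case: l l0 IH {earlier} => // -[|l] _ IH; first exact: (cgrm_start run).
  exact: (IH l.+1 _ _).2.1.
have [K [Kbefore Kend]] : exists K, stage_ends_at ip f' delta eps x y l K.
  apply: contrapT => noend; apply: (noloop l) => // k; split => //.
  (* The first index to pass the stopping test would end the stage. *)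
  suff : forall j, delta l < gap ip f' (eps l) (x l j) (y l j) by [].
  elim/ltn_ind => j jbefore; rewrite ltNge; apply/negP => jend.
  by apply: noend; exists j.
have vK : visited ip f' delta eps x y l K by [].
split; first by exists K.
rewrite (cgrm_stop run vK Kend); split; first exact: visited_iterate_in.
by exists (y l K) => //; exact: (cgrm_step2 run vK).
Qed.

End Run.

(** * Strong convergence of regularized near-minimizers *)

Section TikhonovConvergence.
Context (R : realType) (H : completeNormedModType R).
Context (D : set H) (f : H -> R) (delta eps : nat -> R) (w : nat -> H).
Hypothesis eps0 : forall l, 0 < eps l.
Hypothesis delta_cvg : delta @ \oo --> (0 : R).
Hypothesis eps_cvg : eps @ \oo --> (0 : R).
Hypothesis delta_eps : (fun l => delta l / eps l) @ \oo --> (0 : R).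
Hypothesis wD : forall l, (0 < l)%N -> D (w l).
Hypothesis w_gap : forall l z, (0 < l)%N -> D z ->
  reg f (eps l) (w l) + 2^-1 * eps l * `|z - w l| ^+ 2
    <= reg f (eps l) z + delta l.

Lemma cvg_min_norm (q : H) : minimizers D f q ->
  (forall e : R, 0 < e -> exists2 c, f q < c &
     forall z, D z -> f z <= c -> `|q| ^+ 2 <= `|z| ^+ 2 + e) ->
  w @ \oo --> q.
Proof.
move=> [Dq qmin] qapprox; apply/cvgrPdist_lt => e e0.
(* This tolerance is spent once on the norm of [w l] and twice on [delta l / eps l], so the squared
   distance stays below [3/4 e ^+ 2]. *)
have h0 : 0 < e ^+ 2 / 4 by rewrite divr_gt0// exprn_gt0.
have [c qc cP] := qapprox _ h0.
have cq0 : 0 < c - f q by rewrite subr_gt0.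
have value_cvg : (fun l => 2^-1 * `|q| ^+ 2 * eps l + delta l) @ \oo --> (0 : R).
  rewrite -[X in _ --> X]addr0; apply: cvgD => //.
  by rewrite -[X in _ --> X](mulr0 (2^-1 * `|q| ^+ 2)); exact: cvgMr.
near=> l.
have l0 : (0 < l)%N by near: l; exact: nbhs_infty_gt.
have wl := w_gap l0 Dq; have qw := qmin _ (wD l0).
have small : 2^-1 * `|q| ^+ 2 * eps l + delta l < c - f q.
  apply: (le_lt_trans (ler_norm _)); near: l.
  exact: (cvgr0_norm_lt _ value_cvg).
have ratio : delta l / eps l < e ^+ 2 / 4.
  apply: (le_lt_trans (ler_norm _)); near: l.
  exact: (cvgr0_norm_lt _ delta_eps).
have : `|q| ^+ 2 <= `|w l| ^+ 2 + e ^+ 2 / 4.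
  apply: cP; first exact: wD.
  have : 0 <= 2^-1 * eps l * `|w l| ^+ 2.
    by rewrite !mulr_ge0 ?exprn_ge0// ltW.
  have : 0 <= 2^-1 * eps l * `|q - w l| ^+ 2.
    by rewrite !mulr_ge0 ?exprn_ge0// ltW.
  by move: wl; rewrite /reg; lra.
have : `|w l| ^+ 2 + `|q - w l| ^+ 2 - `|q| ^+ 2 <= 2 * (delta l / eps l).
  rewrite mulrA ler_pdivlMr//; move: wl; rewrite /reg; lra.
move=> ? ?; rewrite -(ltr_pXn2r (n := 2)) ?nnegrE ?normr_ge0 ?(ltW e0)//; lra.
Unshelve. all: by end_near. Qed.

End TikhonovConvergence.

(** * Executability, finite stages and identification of the limit *)

Unset Implicit Arguments.

Theorem theorem3 (R : realType) (H : completeNormedModType R)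
    (ip : {dot H for (@idfun R)}) (ip_norm : inner_product_norm ip)
    (D : set H) (D_nonempty : D !=set0) (D_convex : convex_set D)
    (D_closed : closed D) (D_bounded : bounded_set D)
    (f : H -> R) (f' : H -> H) (L : R)
    (f_convex : convex_function D f)
    (f_grad : gradient_on ip D f f')
    (f'_lipschitz : L.-lipschitz_D f')
    (beta theta : R) (beta01 : 0 < beta < 1) (theta01 : 0 < theta < 1)
    (delta eps : nat -> R)
    (delta_dec : decreases_to0 delta) (eps_dec : decreases_to0 eps)
    (delta_eps : (fun l => delta l / eps l) @ \oo --> (0 : R)) :
  (forall l, (0 < l)%N ->
     steps_executable ip D f f' beta theta delta eps l) /\
  (forall (w : nat -> H) (x y : nat -> nat -> H),
     cgrm_run ip D f f' beta theta delta eps w x y ->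
     (forall l, (0 < l)%N -> exists K, stage_ends_at ip f' delta eps x y l K) /\
     (exists xn : H,
        minimizers (minimizers D f) (fun z : H => 2^-1 * `|z| ^+ 2) = [set xn]
        /\ w @ \oo --> xn)).
Proof.
have [delta0 _ delta_cvg] := delta_dec; have [eps0 _ eps_cvg] := eps_dec.
have epsW l : 0 <= eps l by exact: ltW.
have f_le := convex_gradient_le D_convex f_convex f_grad.
split=> [l _ x Dx|w x y run].
  split.
    (* A linear form is its own subgradient, so the subproblem has a solution. *)
    have linear_sub u : D u -> exists g, forall z, D z ->
        ip (reg_grad f' (eps l) x) u + ip g (z - u)
          <= ip (reg_grad f' (eps l) x) z.
      move=> _; exists (reg_grad f' (eps l) x) => z _.
      by rewrite -linearDr/= addrC subrK.
    have [p [pmin _]] :=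
      minimizer_approx ip_norm D_convex D_nonempty D_closed D_bounded linear_sub.
    by exists p.
  move=> y [Dy _] gap_y.
  have [m mP] := armijo_uniform ip_norm D_nonempty D_convex D_bounded f_le
    f'_lipschitz beta01 theta01 (epsW l).
  apply: (armijo_first_exists (m := m)); apply: mP => //.
  exact: lt_trans (delta0 l) gap_y.
have th0 : 0 < theta by case/andP: theta01.
have noloop l : (forall k, visited ip f' delta eps x y l k) -> D (w l.-1) -> False.
  move=> vl Dw.
  (* Reaching iteration [k.+1] is what records that [k] did not stop. *)
  have gl k : delta l < gap ip f' (eps l) (x l k) (y l k).
    by have [_ _] := vl k.+1; exact.
  have Dxy k : D (x l k) /\ D (y l k).
    split; last exact: (cgrm_step2 run (vl k)).1.
    exact: (visited_iterate_in D_convex delta0 th0 run).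
  apply: (stage_finite ip_norm D_nonempty D_convex D_bounded f_le f'_lipschitz
    beta01 theta01 (epsW l) (delta0 l) Dxy gl).
  by move=> k; exact: (cgrm_step3 run (vl k) (gl k)).
have ends := stages_end D_convex delta0 th0 run noloop.
split=> [l /ends[]//|].
have f_sub u : D u -> exists g, forall z, D z -> f u + ip g (z - u) <= f z.
  by move=> Du; exists (f' u) => z; exact: f_le.
have [p [pmin papprox]] :=
  minimizer_approx ip_norm D_convex D_nonempty D_closed D_bounded f_sub.
have wD l : (0 < l)%N -> D (w l) by case/ends => _ [].
have w_gap l z : (0 < l)%N -> D z ->
    reg f (eps l) (w l) + 2^-1 * eps l * `|z - w l| ^+ 2
      <= reg f (eps l) z + delta l.
  move=> /ends[_ [Dw [u ulin ugap]]] Dz.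
  exact: (reg_small_gap ip_norm f_le Dw Dz ulin ugap).
(* Stated for every [q] no longer than [p]: any other least-norm minimizer would also be the limit
   of [w], so uniqueness of limits gives [q = p]. *)
have w_cvg q : minimizers D f q -> `|q| ^+ 2 <= `|p| ^+ 2 -> w @ \oo --> q.
  move=> qmin qp.
  apply: (cvg_min_norm eps0 delta_cvg eps_cvg delta_eps wD w_gap qmin).
  move=> e /papprox[c pc cP]; exists c.
    by apply: le_lt_trans pc; exact: qmin.2 pmin.1.
  by move=> z Dz /(cP z Dz); exact: le_trans.
exists p; split; last exact: w_cvg.
apply/seteqP; split=> [q [qmin qnorm]|_ ->] /=.
  apply: (cvg_unique _ (w_cvg q qmin _) (w_cvg p pmin _)) => //.
  by have := qnorm p pmin; rewrite ler_pM2l.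
split=> // z zmin; rewrite ler_pM2l//; apply/ler_addgt0Pr => e /papprox[c pc cP].
apply: cP; first exact: zmin.1.
by apply: le_trans (ltW pc); exact: zmin.2 pmin.1.
Qed.
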